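(* $\mathbf{BiInt}$ has the analytic cut property: every sequent provable in $\mathbf{BiInt}$ has a locally analytic $\mathbf{BiInt}$-proof.
   Context: Formulas are built from propositional atoms and constants $\top,\bot$ using binary connectives $\land,\lor,\supset$ (implication) and $\prec$ (coimplication). A sequent is $\Gamma\Rightarrow\Delta$ with $\Gamma,\Delta$ finite multisets of formulas. The calculus $\mathbf{BiInt}$ has the following rules (in each, $\Gamma,\Delta$ are arbitrary multisets, $p$ an atom): initial sequents $\Gamma,p\Rightarrow p,\Delta$; cut: from $\Gamma\Rightarrow A,\Delta$ and $\Gamma,A\Rightarrow\Delta$ infer $\Gamma\Rightarrow\Delta$; left/right weakening and left/right contraction; $\top_L$: from $\Gamma\Rightarrow\Delta$ infer $\Gamma,\top\Rightarrow\Delta$; $\top_R$: $\Gamma\Rightarrow\top,\Delta$ is an axiom; $\bot_L$: $\Gamma,\bot\Rightarrow\Delta$ is an axiom; $\bot_R$: from $\Gamma\Rightarrow\Delta$ infer $\Gamma\Rightarrow\bot,\Delta$; $\land_L$: from $\Gamma,A,B\Rightarrow\Delta$ infer $\Gamma,A\land B\Rightarrow\Delta$; $\land_R$: from $\Gamma\Rightarrow A,\Delta$ and $\Gamma\Rightarrow B,\Delta$ infer $\Gamma\Rightarrow A\land B,\Delta$; $\lor_L$: from $\Gamma,A\Rightarrow\Delta$ and $\Gamma,B\Rightarrow\Delta$ infer $\Gamma,A\lor B\Rightarrow\Delta$; $\lor_R$: from $\Gamma\Rightarrow A,B,\Delta$ infer $\Gamma\Rightarrow A\lor B,\Delta$;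 $\supset_L$: from $\Gamma,A\supset B\Rightarrow A,\Delta$ and $\Gamma,A\supset B,B\Rightarrow\Delta$ infer $\Gamma,A\supset B\Rightarrow\Delta$; $\supset_R$: from $\Gamma,A\Rightarrow B$ infer $\Gamma\Rightarrow A\supset B,\Delta$; $\prec_L$: from $A\Rightarrow B,\Delta$ infer $\Gamma,A\prec B\Rightarrow\Delta$; $\prec_R$: from $\Gamma\Rightarrow A,A\prec B,\Delta$ and $\Gamma,B\Rightarrow A\prec B,\Delta$ infer $\Gamma\Rightarrow A\prec B,\Delta$. A proof is a finite tree of rule instances whose leaves are axioms. An instance of cut with conclusion $\Gamma\Rightarrow\Delta$ and cut-formula $A$ is analytic if $A$ is a subformula of some formula in $\Gamma\cup\Delta$. A proof is locally analytic if every cut in it is analytic. *)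

(* Defs.v *)
From HB Require Import structures.
From mathcomp Require Import all_boot finmap multiset.

Set Implicit Arguments.
Unset Strict Implicit.
Unset Printing Implicit Defensive.

Local Open Scope mset_scope.

Inductive form (atom : Type) : Type :=
| Atom of atom
| Top
| Bot
| And of form atom & form atom
| Or of form atom & form atom
| Imp of form atom & form atom
| Coimp of form atom & form atom.

Arguments Top {atom}.
Arguments Bot {atom}.

(* Multisets are defined over choice types, hence the encoding below. *)
Section FormChoice.
Variable atom : Type.

Fixpoint form_to_tree (A : form atom) : GenTree.tree atom :=
  match A with
  | Atom p => GenTree.Leaf p
  | Top => GenTree.Node 0 [::]
  | Bot => GenTree.Node 1 [::]
  | And A B => GenTree.Node 2 [:: form_to_tree A; form_to_tree B]
  | Or A B => GenTree.Node 3 [:: form_to_tree A; form_to_tree B]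
  | Imp A B => GenTree.Node 4 [:: form_to_tree A; form_to_tree B]
  | Coimp A B => GenTree.Node 5 [:: form_to_tree A; form_to_tree B]
  end.

Fixpoint form_of_tree (t : GenTree.tree atom) : option (form atom) :=
  match t with
  | GenTree.Leaf p => Some (Atom p)
  | GenTree.Node 0 [::] => Some Top
  | GenTree.Node 1 [::] => Some Bot
  | GenTree.Node k [:: t1; t2] =>
      match form_of_tree t1, form_of_tree t2 with
      | Some A, Some B =>
          match k with
          | 2 => Some (And A B)
          | 3 => Some (Or A B)
          | 4 => Some (Imp A B)
          | 5 => Some (Coimp A B)
          | _ => None
          end
      | _, _ => None
      end
  | _ => None
  end.

Lemma form_to_treeK : pcancel form_to_tree form_of_tree.
Proof.
by elim=> //= A -> B ->.
Qed.

End FormChoice.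

HB.instance Definition _ (atom : choiceType) :=
  Choice.copy (form atom) (pcan_type (@form_to_treeK atom)).

Fixpoint subformulas (atom : Type) (A : form atom) : seq (form atom) :=
  A :: match A with
       | Atom _ | Top | Bot => [::]
       | And B C | Or B C | Imp B C | Coimp B C =>
           subformulas B ++ subformulas C
       end.

(* [BiInt G D] is the type of proofs of the sequent G => D; the multiset
   [A +` G] is G with one more occurrence of A. *)
Inductive BiInt (atom : choiceType) :
  {mset form atom} -> {mset form atom} -> Type :=
| Init G D p : BiInt (Atom p +` G) (Atom p +` D)
| Cut G D A : BiInt G (A +` D) -> BiInt (A +` G) D -> BiInt G D
| WeakL G D A : BiInt G D -> BiInt (A +` G) D
| WeakR G D A : BiInt G D -> BiInt G (A +` D)
| ContrL G D A : BiInt (A +` (A +` G)) D -> BiInt (A +` G) D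
| ContrR G D A : BiInt G (A +` (A +` D)) -> BiInt G (A +` D)
| TopL G D : BiInt G D -> BiInt (Top +` G) D
| TopR G D : BiInt G (Top +` D)
| BotL G D : BiInt (Bot +` G) D
| BotR G D : BiInt G D -> BiInt G (Bot +` D)
| AndL G D A B : BiInt (A +` (B +` G)) D -> BiInt (And A B +` G) D
| AndR G D A B :
    BiInt G (A +` D) -> BiInt G (B +` D) -> BiInt G (And A B +` D)
| OrL G D A B :
    BiInt (A +` G) D -> BiInt (B +` G) D -> BiInt (Or A B +` G) D
| OrR G D A B : BiInt G (A +` (B +` D)) -> BiInt G (Or A B +` D)
| ImpL G D A B :
    BiInt (Imp A B +` G) (A +` D) -> BiInt (B +` (Imp A B +` G)) D ->
    BiInt (Imp A B +` G) D
| ImpR G D A B : BiInt (A +` G) [mset B] -> BiInt G (Imp A B +` D)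
| CoimpL G D A B : BiInt [mset A] (B +` D) -> BiInt (Coimp A B +` G) D
| CoimpR G D A B :
    BiInt G (A +` (Coimp A B +` D)) -> BiInt (B +` G) (Coimp A B +` D) ->
    BiInt G (Coimp A B +` D).

Definition provable (atom : choiceType) (G D : {mset form atom}) : Prop :=
  inhabited (BiInt G D).

Definition analytic (atom : choiceType) (G D : {mset form atom})
    (A : form atom) : Prop :=
  exists2 B, (B \in G) || (B \in D) & A \in subformulas B.

Fixpoint locally_analytic (atom : choiceType) (G D : {mset form atom})
    (pi : BiInt G D) {struct pi} : Prop :=
  match pi with
  | Init _ _ _ | TopR _ _ | BotL _ _ => True
  | Cut G D A pi1 pi2 =>
      [/\ analytic G D A, locally_analytic pi1 & locally_analytic pi2]
  | WeakL _ _ _ pi1 | WeakR _ _ _ pi1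
  | ContrL _ _ _ pi1 | ContrR _ _ _ pi1
  | TopL _ _ pi1 | BotR _ _ pi1
  | AndL _ _ _ _ pi1 | OrR _ _ _ _ pi1
  | ImpR _ _ _ _ pi1 | CoimpL _ _ _ _ pi1 => locally_analytic pi1
  | AndR _ _ _ _ pi1 pi2 | OrL _ _ _ _ pi1 pi2
  | ImpL _ _ _ _ pi1 pi2 | CoimpR _ _ _ _ pi1 pi2 =>
      locally_analytic pi1 /\ locally_analytic pi2
  end.

(* Main.v *)
(**
Suppose [G => D] has no locally analytic proof. Analytic cuts on the
subformulas of the sequent extend it to a sequent without locally analytic
proof in which every subformula occurs on one side. Such saturated sequents
are the worlds of a Kripke model, ordered by [G1 => D1] <= [G2 => D2] iff G1 is
contained in G2 and D2 in D1. The rules for implication and coimplication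
discard formulas, so the worlds they call for are saturated with respect to
fewer formulas; this is harmless, since containment on one side then implies
the reverse containment on the other. In this model a world forces its
left-hand formulas and none of its right-hand ones, so by soundness (with
arbitrary cuts) [G => D] is not provable.
*)
Require Import Defs.
From mathcomp Require Import all_boot finmap multiset.
From Stdlib Require Import Classical_Prop.

Set Implicit Arguments.
Unset Strict Implicit.
Unset Printing Implicit Defensive.

Local Open Scope mset_scope.

Local Definition inE := (@in_mset0, @in_mset1D, @in_mset1, inE).

(** * Predicates on multisets closed under weakening and contraction *)

Section SubsetInduction.
Variables (K : choiceType) (P : {mset K} -> Prop).
Hypothesis P_weak : forall x A, P A -> P (x +` A).
Hypothesis P_contr : forall x A, P (x +` (x +` A)) -> P (x +` A).

(** All of [B] is first added to [A] by weakening; the occurrences coming from [A] are then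
    contracted away against those of [B]. *)
Lemma mset_weak_contr A B : {subset A <= B} -> P A -> P B.
Proof.
move=> sAB PA.
have: P (A `+` B).
  rewrite msetDC -(seq_mset_id B); elim: (enum_mset B) => [|x s IHs].
    by rewrite -enum_mset0 seq_mset_id mset0D.
  by rewrite mset_cons -msetDA; apply: P_weak.
have: {subset enum_mset A <= B} by move=> x; apply: sAB.
rewrite -{2}(seq_mset_id A); elim: (enum_mset A) => [|x s IHs] sub_s.
  by rewrite -enum_mset0 seq_mset_id mset0D.
have xB : x \in B by apply: sub_s; rewrite inE eqxx.
(* [msetB1K] exposes an occurrence of [x] in [B], against which the head of the list is
   contracted. *)
rewrite mset_cons -msetDA -{1}(msetB1K xB) (msetDCA (seq_mset s)).
move=> /P_contr; rewrite msetDCA msetB1K //; apply: IHs => y ys.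
by apply: sub_s; rewrite inE ys orbT.
Qed.

End SubsetInduction.

(** * Subformulas and analyticity *)

Section Subformulas.
Variable atom : choiceType.
Implicit Types (A B C : form atom) (G D : {mset form atom}).

Lemma subformulas_refl A : A \in subformulas A.
Proof. by case: A => *; rewrite inE eqxx. Qed.

Lemma subformulas_trans A B C :
  A \in subformulas B -> B \in subformulas C -> A \in subformulas C.
Proof.
move=> AB; elim: C => [p|||C1 IH1 C2 IH2|C1 IH1 C2 IH2|C1 IH1 C2 IH2
    |C1 IH1 C2 IH2] /=; rewrite in_cons => /predU1P[eqB|];
  by [rewrite eqB in AB | rewrite in_cons !mem_cat => /orP[/IH1|/IH2] ->;
      rewrite ?orbT | ].
Qed.

Lemma analytic_sub G D G' D' A :
  (forall B, (B \in G) || (B \in D) -> analytic G' D' B) ->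
  analytic G D A -> analytic G' D' A.
Proof.
by move=> sub [B /sub[C CGD BC] AB]; exists C => //; apply: subformulas_trans BC.
Qed.

Lemma analytic_mem G D A : (A \in G) || (A \in D) -> analytic G D A.
Proof. by move=> ?; exists A => //; apply: subformulas_refl. Qed.

End Subformulas.

(** * Locally analytic derivability, with rules in cumulative form *)

Section LocallyAnalytic.
Variable atom : choiceType.
Implicit Types (A B : form atom) (G D : {mset form atom}).

Definition la_provable G D := exists pi : BiInt G D, locally_analytic pi.

(** Weakening and contraction introduce no cuts, so multiplicities can be ignored and sequents
    handled as pairs of sets. *)
Lemma la_sub G D G' D' :
  {subset G <= G'} -> {subset D <= D'} -> la_provable G D -> la_provable G' D'.
Proof.
move=> sG sD laGD.
have : la_provable G' D.
  apply: (mset_weak_contr (P := fun G => la_provable G D)) sG laGD => x A [pi la].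
  - by exists (WeakL x pi).
  - by exists (ContrL pi).
apply: mset_weak_contr sD => x A [pi la].
- by exists (WeakR x pi).
- by exists (ContrR pi).
Qed.

Local Ltac sub_mset :=
  let C := fresh "C" in move=> C; rewrite !inE ?orbF;
  repeat match goal with
  | |- is_true (_ || _) -> _ => case/orP
  | |- is_true (_ == _) -> _ => move/eqP->
  end; rewrite ?eqxx ?orbT //; try by move=> ->; rewrite ?orbT.

Lemma la_cut G D A : analytic G D A ->
  la_provable G (A +` D) -> la_provable (A +` G) D -> la_provable G D.
Proof. by move=> an [pi1 la1] [pi2 la2]; exists (Cut pi1 pi2). Qed.

(** Induction on [A] without cuts: the left and right rules of the main connective reduce the claim
    to its arguments, and [la_sub] adjusts the contexts. This is what keeps the two sides of a world
    disjoint. *)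
Lemma la_id G D A : A \in G -> A \in D -> la_provable G D.
Proof.
have sub1 G' : A \in G' -> {subset [mset A] <= G'}.
  by move=> AG B; rewrite inE => /eqP->.
move=> /sub1 sG /sub1 sD; apply: la_sub sG sD _.
elim: A {sub1} => [p|||A [pA lA] B [pB lB]|A [pA lA] B [pB lB]
    |A [pA lA] B [pB lB]|A [pA lA] B [pB lB]].
- by rewrite -(msetD0 [mset _]); exists (Init mset0 mset0 p).
- by rewrite -{2}(msetD0 [mset _]); exists (TopR _ _).
- by rewrite -{1}(msetD0 [mset _]); exists (BotL _ _).
- rewrite -(msetD0 [mset And A B]).
  have [||qA kA] := la_sub (G' := A +` (B +` mset0)) (D' := A +` mset0) _ _
    (ex_intro _ pA lA); [sub_mset| sub_mset|].
  have [||qB kB] := la_sub (G' := A +` (B +` mset0)) (D' := B +` mset0) _ _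
    (ex_intro _ pB lB); [sub_mset|sub_mset|].
  by exists (AndL (AndR qA qB)).
- rewrite -(msetD0 [mset Or A B]).
  have [||qA kA] := la_sub (G' := A +` mset0) (D' := A +` (B +` mset0)) _ _
    (ex_intro _ pA lA); [sub_mset|sub_mset|].
  have [||qB kB] := la_sub (G' := B +` mset0) (D' := A +` (B +` mset0)) _ _
    (ex_intro _ pB lB); [sub_mset|sub_mset|].
  by exists (OrR (OrL qA qB)).
- rewrite -{2}(msetD0 [mset Imp A B]).
  have [||qA kA] := la_sub (G' := Imp A B +` [mset A]) (D' := A +` [mset B])
    _ _ (ex_intro _ pA lA); [sub_mset|sub_mset|].
  have [||qB kB] := la_sub (G' := B +` (Imp A B +` [mset A])) (D' := [mset B])
    _ _ (ex_intro _ pB lB); [sub_mset|sub_mset|].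
  have: la_provable (A +` [mset Imp A B]) [mset B].
    by rewrite msetDC; exists (ImpL qA qB).
  by case=> q k; exists (ImpR mset0 q).
- rewrite -{1}(msetD0 [mset Coimp A B]).
  have [||qA kA] := la_sub (G' := [mset A])
    (D' := A +` (Coimp A B +` [mset B])) _ _ (ex_intro _ pA lA);
    [sub_mset|sub_mset|].
  have [||qB kB] := la_sub (G' := B +` [mset A]) (D' := Coimp A B +` [mset B])
    _ _ (ex_intro _ pB lB); [sub_mset|sub_mset|].
  have: la_provable [mset A] (B +` [mset Coimp A B]).
    by rewrite msetDC; exists (CoimpR qA qB).
  by case=> q k; exists (CoimpL mset0 q).
Qed.

(** Contraction lets a principal formula remain in the premises, so that rules can be read backwards
    on a saturated sequent, which never loses formulas. *)
Lemma la_absorbL G D A : A \in G -> la_provable (A +` G) D -> la_provable G D.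
Proof. by move=> AG; apply: la_sub => // B; rewrite !inE => /predU1P[->|]. Qed.

Lemma la_absorbR G D A : A \in D -> la_provable G (A +` D) -> la_provable G D.
Proof. by move=> AD; apply: la_sub => // B; rewrite !inE => /predU1P[->|]. Qed.

Lemma la_topR G D : Top \in D -> la_provable G D.
Proof. by move/la_absorbR; apply; exists (TopR _ _). Qed.

Lemma la_botL G D : Bot \in G -> la_provable G D.
Proof. by move/la_absorbL; apply; exists (BotL _ _). Qed.

Lemma la_andL G D A B : And A B \in G ->
  la_provable (A +` (B +` G)) D -> la_provable G D.
Proof. by move=> /la_absorbL AG [pi la]; apply: AG; exists (AndL pi). Qed.

Lemma la_andR G D A B : And A B \in D ->
  la_provable G (A +` D) -> la_provable G (B +` D) -> la_provable G D.
Proof.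
by move=> /la_absorbR AD [pi1 la1] [pi2 la2]; apply: AD; exists (AndR pi1 pi2).
Qed.

Lemma la_orL G D A B : Or A B \in G ->
  la_provable (A +` G) D -> la_provable (B +` G) D -> la_provable G D.
Proof.
by move=> /la_absorbL AG [pi1 la1] [pi2 la2]; apply: AG; exists (OrL pi1 pi2).
Qed.

Lemma la_orR G D A B : Or A B \in D ->
  la_provable G (A +` (B +` D)) -> la_provable G D.
Proof. by move=> /la_absorbR AD [pi la]; apply: AD; exists (OrR pi). Qed.

Lemma la_impL G D A B : Imp A B \in G ->
  la_provable G (A +` D) -> la_provable (B +` G) D -> la_provable G D.
Proof.
move=> /msetB1K <- [pi1 la1] [pi2 la2]; by exists (ImpL pi1 pi2).
Qed.

Lemma la_impR G D A B : Imp A B \in D ->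
  la_provable (A +` G) [mset B] -> la_provable G D.
Proof. by move=> /la_absorbR AD [pi la]; apply: AD; exists (ImpR D pi). Qed.

Lemma la_coimpL G D A B : Coimp A B \in G ->
  la_provable [mset A] (B +` D) -> la_provable G D.
Proof. by move=> /la_absorbL AG [pi la]; apply: AG; exists (CoimpL G pi). Qed.

Lemma la_coimpR G D A B : Coimp A B \in D ->
  la_provable G (A +` D) -> la_provable (B +` G) D -> la_provable G D.
Proof.
move=> /msetB1K <- [pi1 la1] [pi2 la2]; by exists (CoimpR pi1 pi2).
Qed.

End LocallyAnalytic.

(** * Kripke semantics and soundness *)

Section Kripke.
Variables (atom : choiceType) (W : Type) (le : W -> W -> Prop).
Variable val : W -> atom -> Prop.
Hypothesis le_refl : forall w, le w w.
Hypothesis le_trans : forall w2 w1 w3, le w1 w2 -> le w2 w3 -> le w1 w3.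
Hypothesis val_mono : forall w w' p, le w w' -> val w p -> val w' p.

Fixpoint forces (w : W) (A : form atom) : Prop :=
  match A with
  | Atom p => val w p
  | Top => True
  | Bot => False
  | And A B => forces w A /\ forces w B
  | Or A B => forces w A \/ forces w B
  | Imp A B => forall w', le w w' -> forces w' A -> forces w' B
  | Coimp A B => exists w', [/\ le w' w, forces w' A & ~ forces w' B]
  end.

(** Only atoms, conjunction and disjunction need the induction; implication looks upwards and
    coimplication downwards, so transitivity settles both. *)
Lemma forces_mono w w' A : le w w' -> forces w A -> forces w' A.
Proof.
elim: A => [p|||A IHA B IHB|A IHA B IHB|A _ B _|A _ B _] //= leww'.
- exact: val_mono.
- by case=> /IHA ? /IHB ?; split; auto.
- by case=> [/IHA|/IHB] ?; [left|right]; auto.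
- by move=> AB w'' /(le_trans leww'); apply: AB.
- by case=> u [leu Au nBu]; exists u; split=> //; apply: le_trans leww'.
Qed.

Definition forces_all w (G : {mset form atom}) :=
  forall A, A \in G -> forces w A.

Definition forces_some w (D : {mset form atom}) :=
  exists2 A, A \in D & forces w A.

Lemma forces_allD1 w A G :
  forces_all w (A +` G) <-> forces w A /\ forces_all w G.
Proof.
split=> [wG|[wA wG] C]; last by rewrite !inE => /predU1P[->|/wG].
by split=> [|C CG]; apply: wG; rewrite !inE ?eqxx ?CG ?orbT.
Qed.

Lemma forces_all1 w A : forces_all w [mset A] <-> forces w A.
Proof. by split=> [|wA C]; [apply; rewrite mset11|rewrite !inE => /eqP->]. Qed.

Lemma forces_someD1 w A D :
  forces_some w (A +` D) <-> forces w A \/ forces_some w D.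
Proof.
split=> [[C]|[wA|[C CD wC]]].
- by rewrite !inE => /predU1P[->|CD] wC; [left|right; exists C].
- by exists A; rewrite // !inE eqxx.
- by exists C; rewrite // !inE CD orbT.
Qed.

Lemma forces_some1 w A : forces_some w [mset A] <-> forces w A.
Proof.
split=> [[C]|wA]; first by rewrite !inE => /eqP->.
by exists A; rewrite // mset11.
Qed.

Lemma soundness G D : BiInt G D ->
  forall w, forces_all w G -> forces_some w D.
Proof.
elim=> {G D} /=.
- by move=> G D p w /forces_allD1[wp _]; apply/forces_someD1; left.
- by move=> G D A _ IH1 _ IH2 w wG; case/forces_someD1: (IH1 w wG) => // wA;
    apply: IH2; apply/forces_allD1.
- by move=> G D A _ IH w /forces_allD1[_]; apply: IH.
- by move=> G D A _ IH w /IH ?; apply/forces_someD1; right.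
- move=> G D A _ IH w wG; apply: IH; apply/forces_allD1; split=> //.
  by case/forces_allD1: wG.
- by move=> G D A _ IH w /IH /forces_someD1[wA|//]; apply/forces_someD1; left.
- by move=> G D _ IH w /forces_allD1[_]; apply: IH.
- by move=> G D w _; apply/forces_someD1; left.
- by move=> G D w /forces_allD1[].
- by move=> G D _ IH w /IH ?; apply/forces_someD1; right.
- move=> G D A B _ IH w /forces_allD1[[wA wB] wG]; apply: IH.
  by apply/forces_allD1; split=> //; apply/forces_allD1.
- move=> G D A B _ IH1 _ IH2 w wG; apply/forces_someD1.
  case/forces_someD1: (IH1 w wG) => [wA|]; last by right.
  by case/forces_someD1: (IH2 w wG) => [wB|]; [left|right].
- by move=> G D A B _ IH1 _ IH2 w /forces_allD1[[w1|w1] wG];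
    [apply: IH1|apply: IH2]; apply/forces_allD1.
- move=> G D A B _ IH w /IH /forces_someD1[wA|/forces_someD1[wB|wD]];
    apply/forces_someD1.
  + by left; left.
  + by left; right.
  + by right.
- move=> G D A B _ IH1 _ IH2 w wG.
  case/forces_someD1: (IH1 w wG) => // wA.
  apply: IH2; apply/forces_allD1; split=> //.
  by case/forces_allD1: wG => wAB _; apply: wAB wA.
(* The left context persists to the successor [w'], where the premise yields [B]. *)
- move=> G D A B _ IH w wG; apply/forces_someD1; left=> w' leww' wA.
  apply/forces_some1/IH/forces_allD1; split=> // C /wG; exact: forces_mono.
(* Dually, the premise is applied at the predecessor [w'], and the formula of [D] forced there
   persists up to [w]. *)
- move=> G D A B _ IH w /forces_allD1[[w' [lew'w wA nwB]] wG].
  case/forces_all1/IH/forces_someD1: wA => // -[C CD wC]; exists C => //.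
  exact: forces_mono wC.
- move=> G D A B _ IH1 _ IH2 w wG.
  (* If [B] fails at [w], then [w] itself witnesses the coimplication, by reflexivity. *)
  case/forces_someD1: (IH1 w wG) => // wA; case: (classic (forces w B)) => wB.
    by apply: IH2; apply/forces_allD1.
  by apply/forces_someD1; left; exists w.
Qed.

End Kripke.

(** * The canonical model of saturated sequents *)

Section CanonicalModel.
Variable atom : choiceType.
Implicit Types (A B : form atom) (G D : {mset form atom}).

(** Saturation refers to the subformulas of the world's own sequent, not of a fixed initial one, so
    different worlds may decide different sets of formulas. *)
Record world := World {
  pos : {mset form atom};
  neg : {mset form atom};
  world_unprovable : ~ la_provable pos neg;
  world_saturated :
    forall A, analytic pos neg A -> (A \in pos) || (A \in neg)
}.

(** The formulas of [s] are decided one at a time: each goes to the right if that stays unprovable,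
    and otherwise to the left. *)
Lemma saturate_seq G D (s : seq (form atom)) :
  (forall A, A \in s -> analytic G D A) -> ~ la_provable G D ->
  exists G' D', [/\ {subset G <= G'}, {subset D <= D'}, ~ la_provable G' D',
    forall A, (A \in G') || (A \in D') -> analytic G D A &
    forall A, A \in s -> (A \in G') || (A \in D')].
Proof.
move=> an_s nla; elim: s an_s => [|A s IHs] an_s.
  by exists G, D; split=> // A /analytic_mem.
have [|G' [D' [sG sD nla' anGD mem_s]]] := IHs.
  by move=> B Bs; apply: an_s; rewrite inE Bs orbT.
have anA : analytic G D A by apply: an_s; rewrite inE eqxx.
have [la1|nla1] := classic (la_provable G' (A +` D')); last first.
  exists G', (A +` D'); split=> // B; rewrite !inE.
  - by move/sD => ->; rewrite orbT.
  - by rewrite orbCA => /predU1P[->|/anGD].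
  - by rewrite orbCA => /predU1P[->|/mem_s ->]; rewrite ?eqxx ?orbT.
exists (A +` G'), D'; split=> //.
- by move=> B /sG; rewrite !inE => ->; rewrite orbT.
(* Were both placements provable, a cut on [A] would prove the sequent; it is analytic because [G]
   and [D] are contained in the conclusion. *)
- move=> la2; apply: nla'; apply: la_cut la1 la2.
  apply: analytic_sub anA => B; case/orP=> [/sG|/sD] BGD;
  by apply: analytic_mem; rewrite BGD ?orbT.
- by move=> B; rewrite !inE -orbA => /predU1P[->|/anGD].
- by move=> B; rewrite !inE -orbA => /predU1P[->|/mem_s ->];
    rewrite ?eqxx ?orbT.
Qed.

Lemma saturate G D : ~ la_provable G D ->
  exists w : world, [/\ {subset G <= pos w}, {subset D <= neg w} &
    forall A, (A \in pos w) || (A \in neg w) -> analytic G D A].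
Proof.
move=> nla; pose s := flatten [seq subformulas A | A <- (G : seq _) ++ D].
have an_s A : analytic G D A <-> A \in s.
  split=> [[B BGD AB]|/flattenP[_ /mapP[B BGD ->] AB]].
    apply/flattenP; exists (subformulas B) => //.
    by apply: map_f; rewrite mem_cat.
  by exists B; rewrite // -mem_cat.
have [|G' [D' [sG sD nla' anGD mem_s]]] := @saturate_seq G D s _ nla.
  by move=> A /an_s.
(* The extension contains only subformulas of the original sequent, so deciding those once leaves
   nothing undecided. *)
have sat A : analytic G' D' A -> (A \in G') || (A \in D').
  by move=> anA; apply/mem_s/an_s/(analytic_sub anGD).
by exists (World nla' sat).
Qed.

Definition world_le (w w' : world) :=
  {subset pos w <= pos w'} /\ {subset neg w' <= neg w}.

Definition world_val (w : world) (p : atom) : Prop := Atom p \in pos w.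

Lemma world_disjoint w A : A \in pos w -> A \in neg w -> False.
Proof. by move=> Ap An; apply: (world_unprovable (w := w)); apply: la_id An. Qed.

Lemma world_sub w A B : (A \in pos w) || (A \in neg w) ->
  B \in subformulas A -> (B \in pos w) || (B \in neg w).
Proof. by move=> Aw BA; apply: world_saturated; exists A. Qed.

Definition world_forces := forces world_le world_val.

(** A formula of [neg w'] is decided in [w]; on the left of [w] it would also be on the left of
    [w'], against disjointness. *)
Lemma world_leP w w' : {subset pos w <= pos w'} ->
  (forall A, (A \in pos w') || (A \in neg w') -> analytic (pos w) (neg w) A) ->
  world_le w w'.
Proof.
move=> sub_pos an; split=> // A Aw'.
have /an/world_saturated/orP[/sub_pos Apos|//] :
  (A \in pos w') || (A \in neg w') by rewrite Aw' orbT.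
by case: (world_disjoint Apos Aw').
Qed.

Lemma world_geP w w' : {subset neg w <= neg w'} ->
  (forall A, (A \in pos w') || (A \in neg w') -> analytic (pos w) (neg w) A) ->
  world_le w' w.
Proof.
move=> sub_neg an; split=> // A Aw'.
have /an/world_saturated/orP[//|/sub_neg Aneg] :
  (A \in pos w') || (A \in neg w') by rewrite Aw'.
by case: (world_disjoint Aw' Aneg).
Qed.

(** The world saturates the premise of the right implication rule. That premise consists of
    subformulas of [w], so [world_leP] recovers the order although [neg w] was discarded. *)
Lemma world_impR w A B : Imp A B \in neg w ->
  exists w', [/\ world_le w w', A \in pos w' & B \in neg w'].
Proof.
move=> ABw.
have /saturate[w' [sG sD an]] : ~ la_provable (A +` pos w) [mset B].
  by move/(la_impR ABw)/(world_unprovable (w := w)).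
exists w'; split; [|by apply: sG; rewrite mset1D1|by apply: sD; rewrite mset11].
apply: world_leP => [C Cw|C /an].
  by apply: sG; rewrite !inE Cw orbT.
apply: analytic_sub => E; rewrite !inE -orbA.
case/or3P=> [/eqP->|Ew|/eqP->].
- by exists (Imp A B); rewrite ?ABw ?orbT // inE mem_cat subformulas_refl orbT.
- by apply: analytic_mem; rewrite Ew.
- by exists (Imp A B); rewrite ?ABw ?orbT // inE mem_cat subformulas_refl !orbT.
Qed.

Lemma world_coimpL w A B : Coimp A B \in pos w ->
  exists w', [/\ world_le w' w, A \in pos w' & B \in neg w'].
Proof.
move=> ABw.
have /saturate[w' [sG sD an]] : ~ la_provable [mset A] (B +` neg w).
  by move/(la_coimpL ABw)/(world_unprovable (w := w)).
exists w'; split; [|by apply: sG; rewrite mset11|by apply: sD; rewrite mset1D1].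
apply: world_geP => [C Cw|C /an].
  by apply: sD; rewrite !inE Cw orbT.
apply: analytic_sub => E; rewrite !inE.
case/or3P=> [/eqP->|/eqP->|Ew].
- by exists (Coimp A B); rewrite ?ABw // inE mem_cat subformulas_refl orbT.
- by exists (Coimp A B); rewrite ?ABw // inE mem_cat subformulas_refl !orbT.
- by apply: analytic_mem; rewrite Ew orbT.
Qed.

(** Arguments of a decided formula are decided; if they lay on the wrong side, one rule and [la_id]
    would prove the world's sequent. Negative implications and positive coimplications instead need
    a new world. *)
Lemma truth A w :
  (A \in pos w -> world_forces w A) /\ (A \in neg w -> ~ world_forces w A).
Proof.
have argl X C1 C2 u : subformulas X = X :: subformulas C1 ++ subformulas C2 ->
    (X \in pos u) || (X \in neg u) -> (C1 \in pos u) || (C1 \in neg u).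
  by move=> eqX /world_sub; apply; rewrite eqX inE mem_cat subformulas_refl orbT.
have argr X C1 C2 u : subformulas X = X :: subformulas C1 ++ subformulas C2 ->
    (X \in pos u) || (X \in neg u) -> (C2 \in pos u) || (C2 \in neg u).
  by move=> eqX /world_sub; apply; rewrite eqX inE mem_cat subformulas_refl !orbT.
have nla u := world_unprovable (w := u).
elim: A w => [p|||A /all_and2[pA nA] B /all_and2[pB nB]
    |A /all_and2[pA nA] B /all_and2[pB nB]
    |A /all_and2[pA nA] B /all_and2[pB nB]
    |A /all_and2[pA nA] B /all_and2[pB nB]] w;
  rewrite /world_forces /=; split=> // ABw.
- by move=> /world_disjoint; apply.
- by case: (nla w); apply: la_topR.
- by case: (nla w); apply: la_botL.
- by case.
- have Xw : (And A B \in pos w) || (And A B \in neg w) by rewrite ABw.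
  have /orP[/pA ?|Aw] := argl (And A B) A B _ erefl Xw; last first.
    by case: (nla w); apply: la_andL ABw (la_id _ Aw); rewrite mset1D1.
  have /orP[/pB ?|Bw] := argr (And A B) A B _ erefl Xw; first by [].
  by case: (nla w); apply: la_andL ABw (la_id _ Bw); rewrite !inE eqxx orbT.
- have Xw : (And A B \in pos w) || (And A B \in neg w) by rewrite ABw orbT.
  case=> fA fB.
  have /orP[Aw|/nA //] := argl (And A B) A B _ erefl Xw.
  have /orP[Bw|/nB //] := argr (And A B) A B _ erefl Xw.
  by case: (nla w); apply: la_andR ABw (la_id Aw _) (la_id Bw _);
    rewrite mset1D1.
- have Xw : (Or A B \in pos w) || (Or A B \in neg w) by rewrite ABw.
  have /orP[/pA ?|Aw] := argl (Or A B) A B _ erefl Xw; first by left.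
  have /orP[/pB ?|Bw] := argr (Or A B) A B _ erefl Xw; first by right.
  by case: (nla w); apply: la_orL ABw (la_id _ Aw) (la_id _ Bw);
    rewrite mset1D1.
- have Xw : (Or A B \in pos w) || (Or A B \in neg w) by rewrite ABw orbT.
  have /orP[Aw|/nA nfA] := argl (Or A B) A B _ erefl Xw.
    by case: (nla w); apply: la_orR ABw (la_id Aw _); rewrite mset1D1.
  have /orP[Bw|/nB nfB] := argr (Or A B) A B _ erefl Xw; last by case.
  by case: (nla w); apply: la_orR ABw (la_id Bw _); rewrite !inE eqxx orbT.
(* The implication itself moves up to [w'], so its arguments are decided there and the left rule
   applies at [w']. *)
- move=> w' [sub_pos _] fA; have {}ABw := sub_pos _ ABw.
  have Xw : (Imp A B \in pos w') || (Imp A B \in neg w') by rewrite ABw.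
  have /orP[Aw|/nA //] := argl (Imp A B) A B _ erefl Xw.
  have /orP[/pB //|Bw] := argr (Imp A B) A B _ erefl Xw.
  by case: (nla w'); apply: la_impL ABw (la_id Aw _) (la_id _ Bw);
    rewrite mset1D1.
- have [w' [leww' /pA fA /nB nfB]] := world_impR ABw.
  by move/(_ w' leww' fA).
- have [w' [lew'w /pA fA /nB nfB]] := world_coimpL ABw.
  by exists w'.
(* Right-hand formulas move down the order, so the coimplication is refuted at the predecessor [w']
   itself. *)
- case=> w' [[_ sub_neg] fA nfB]; have {}ABw := sub_neg _ ABw.
  have Xw : (Coimp A B \in pos w') || (Coimp A B \in neg w').
    by rewrite ABw orbT.
  have /orP[Aw|/nA //] := argl (Coimp A B) A B _ erefl Xw.
  have /orP[/pB //|Bw] := argr (Coimp A B) A B _ erefl Xw.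
  by case: (nla w'); apply: la_coimpR ABw (la_id Aw _) (la_id _ Bw);
    rewrite mset1D1.
Qed.

End CanonicalModel.

Theorem theorem2 (atom : choiceType) (G D : {mset form atom}) :
  provable G D -> exists pi : BiInt G D, locally_analytic pi.
Proof.
case=> pi; apply: NNPP => /saturate[w [sG sD _]].
have [||||A /sD Aneg fA] :=
  @soundness atom (world atom) (@world_le atom) (@world_val atom) _ _ _ G D pi w.
- by move=> u; split=> A.
- by move=> w2 w1 w3 [p12 n12] [p23 n23]; split=> A; auto.
- by move=> w1 w2 p [sub_pos _]; apply: sub_pos.
- by move=> A /sG; case: (truth A w).
- by case: (truth A w) => _ /(_ Aneg).
Qed.
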